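(* Let $A,B\in\bigwedge^pX$ ($p\ge1$) be unit blades in a Euclidean space $X$ such that $V=[A]$ and $W=[B]$ satisfy $V\cap W=\{0\}$. Fix associated principal bases $\beta_V=(e_1,\ldots,e_p)$ and $\beta_W=(f_1,\ldots,f_p)$ of $V$ and $W$, with principal bivectors $I_1,\ldots,I_p$, and let $^*$ denote the dual with respect to $J=I_1I_2\cdots I_p$, i.e. $C^*=CJ^{-1}$. Let $\Phi_{V,W^\perp}$ and $\Phi_{A,B^*}$ be formed using the basis $\beta_V$ and the principal vectors $e_1^\perp,\ldots,e_p^\perp$, where $e_i^\perp=I_if_i$. Then $$(e^{\Phi_{V,W}})^*=e^{\Phi_{V,W^\perp}}\qquad\text{and}\qquad (e^{\Phi_{A,B}})^*=e^{\Phi_{A,B^*}}.$$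
   Context: $X$ is an $n$-dimensional Euclidean space. $\bigwedge X$ is its exterior algebra, equipped with the Clifford geometric product (written by juxtaposition), for which $vw=v\cdot w+v\wedge w$ for $v,w\in X$. $\bigwedge X$ carries the usual inner product and norm $\|\cdot\|$. For $M\in\bigwedge X$, $e^M=\sum_{k\ge0}M^k/k!$, and $\tilde M$ is its reversion (so $\tilde I=-I$ for a bivector $I$). A $p$-blade ($p\ge1$) is $A=v_1\wedge\cdots\wedge v_p$ with $v_i\in X$; if $A\ne0$, $[A]=\mathrm{span}(v_1,\ldots,v_p)$. $W^\perp$ is the orthogonal complement of $W$. Principal angles and bases: for nonzero subspaces $V,U$ of dimensions $p,q$ and $m=\min\{p,q\}$, the principal angles $0\le\theta_1\le\cdots\le\theta_m\le\frac\pi2$ and associated principal bases (orthonormal bases) $(e_1,\ldots,e_p)$ of $V$ and $(u_1,\ldots,u_q)$ of $U$ are characterized by $e_i\cdot u_j=\delta_{ij}\cos\theta_i$ for all $i\le p$, $j\le q$ (up to a common reordering of indices to make the angles non-decreasing). Angle bivector, equal dimensions $p=q$: the principal bivectors are $I_i=0$ if $e_i=u_i$, and $I_i=\frac{e_i\wedge u_i}{\|e_i\wedge u_i\|}$ otherwise; $\Phi_{V,U}=\sum_{i=1}^p\theta_iI_i$. If $V=[A]$, $U=[C]$ with $A=\epsilon_A\|A\|e_1\cdots e_p$ and $C=\epsilon_C\|C\|u_1\cdots u_p$, $\epsilon_A,\epsilon_C\in\{\pm1\}$, then with $\epsilon_{A,C}=\epsilon_A\epsilon_C$ the oriented angle bivector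 is $\Phi_{A,C}=\Phi_{V,U}$ if $\epsilon_{A,C}=1$, and $\Phi_{A,C}=\Phi_{V,U}-\pi I_{\max}$ if $\epsilon_{A,C}=-1$, where $I_{\max}$ is the principal bivector of the last index in the non-decreasing ordering of the principal angles. For $p<q$: $\Phi_{V,U}=\Phi_{V,U_P}$, where $U_P=\mathrm{span}(u_1,\ldots,u_p)$. In the situation of the claim, $\theta_1\le\cdots\le\theta_p$ denote the principal angles of $V$ and $W$, $I_i=\frac{e_i\wedge f_i}{\|e_i\wedge f_i\|}$ for all $i$, $[J]=V\oplus W$, $e_i^\perp$ is the normalized component of $e_i$ orthogonal to $W$, and $(e_1^\perp,\ldots,e_p^\perp)$ is completed to a principal basis of $W^\perp$ with respect to $V$, with $e_i$ and $e_i^\perp$ making the principal angle $\frac\pi2-\theta_i$. Thus $\Phi_{V,W^\perp}=\sum_{i=1}^p(\frac\pi2-\theta_i)\tilde I_i$, and $[B^*]=\mathrm{span}(e_1^\perp,\ldots,e_p^\perp)$.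
   Formalization: The second identity is false as stated when A = −B* (all θ_i = π/2, opposite orientations: Φ_{A,B*} = 0 but (e^{Φ_{A,B}})^* = −1); it is stated for A ≠ −B*, and for A = −B* with the reversed I_k used as I_max. X is taken as R^n. *)

(* Defs.v *)
From HB Require Import structures.
From mathcomp Require Import all_boot all_order all_algebra.
From mathcomp Require Import all_classical all_reals all_analysis.
From mathcomp Require Import ring.
Import numFieldNormedType.Exports.

Set Implicit Arguments.
Unset Strict Implicit.
Unset Printing Implicit Defensive.

Import Order.TTheory GRing.Theory Num.Theory.
Local Open Scope ring_scope.

(* The Euclidean space X is R^n = 'rV[R]_n with the standard inner product;
   [orthov dot W] is then the orthogonal complement of W.                     *)
Section Dot.
Variables (R : realType) (n : nat).
Implicit Types u v : 'rV[R]_n.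

Definition dot u v : R := (u *m v^T) 0 0.

Lemma dotE u v : dot u v = \sum_i u 0 i * v 0 i.
Proof. by rewrite /dot mxE; apply: eq_bigr => i _; rewrite mxE. Qed.

Lemma dotC u v : dot u v = dot v u.
Proof. by rewrite !dotE; apply: eq_bigr => i _; rewrite mulrC. Qed.

Fact dot_is_bilinear : bilinear_for
  (GRing.Scale.Law.clone _ _ *%R _)
  (GRing.Scale.Law.clone _ _ (idfun \; *%R) _) dot.
Proof.
have dotP a u v w : dot (a *: u + v) w = a * dot u w + dot v w.
  by rewrite /dot mulmxDl -scalemxAl !mxE.
split=> u a v w /=; first exact: dotP.
by rewrite dotC dotP 2![dot _ u]dotC.
Qed.

HB.instance Definition _ := bilinear_isBilinear.Build R
  'rV[R]_n 'rV[R]_n R _ _ dot dot_is_bilinear.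

Fact dot_hermitian u v : dot u v = (-1) ^+ false * idfun (dot v u).
Proof. by rewrite mul1r /= dotC. Qed.

HB.instance Definition _ :=
  @isHermitianSesquilinear.Build R 'rV[R]_n false idfun dot dot_hermitian.

Fact dot_gt0 u : u != 0 -> 0 < dot u u.
Proof.
move=> u_neq0; have sq_ge0 i : 0 <= u 0 i * u 0 i by rewrite -expr2 sqr_ge0.
rewrite dotE lt_neqAle sumr_ge0 // andbT eq_sym psumr_neq0 //.
have [i ui_neq0] := rV0Pn _ u_neq0.
by apply/hasP; exists i; rewrite ?mem_index_enum //= lt0r mulf_neq0 /=.
Qed.

HB.instance Definition _ := @isDotProduct.Build R 'rV[R]_n dot dot_gt0.

End Dot.

(* A multivector M is the family of its coordinates [M S] in the orthonormal
   basis e_S = e_(i_1) e_(i_2) ... e_(i_r), S = {i_1 < ... < i_r}, of the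
   exterior algebra.  The alias hides the pointwise ring structure of {ffun}. *)
Definition multivector (R : comNzRingType) (n : nat) :=
  {ffun {set 'I_n} -> R}.

HB.instance Definition _ (R : comNzRingType) (n : nat) :=
  GRing.Lmodule.copy (multivector R n) {ffun {set 'I_n} -> R^o}.

Section SymmetricDifference.
Variable T : finType.
Implicit Types A B C : {set T}.

Definition symdiff A B : {set T} := (A :\: B) :|: (B :\: A).

Lemma in_symdiff A B x : (x \in symdiff A B) = (x \in A) (+) (x \in B).
Proof. by rewrite !inE; case: (x \in A); case: (x \in B). Qed.

Lemma symdiffA A B C : symdiff A (symdiff B C) = symdiff (symdiff A B) C.
Proof. by apply/setP=> x; rewrite !in_symdiff addbA. Qed.

Lemma symdiffC A B : symdiff A B = symdiff B A.
Proof. by apply/setP=> x; rewrite !in_symdiff addbC. Qed.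

Lemma symdiff0 A : symdiff A finset.set0 = A.
Proof. by apply/setP=> x; rewrite in_symdiff !inE addbF. Qed.

Lemma symdiffK A B : symdiff A (symdiff A B) = B.
Proof. by apply/setP=> x; rewrite !in_symdiff addbA addbb. Qed.

Lemma symdiff_eq A B C : (symdiff A B == C) = (B == symdiff A C).
Proof.
by apply/eqP/eqP => [<-|->]; rewrite symdiffK.
Qed.

Lemma symdiff_disjoint A B : [disjoint A & B] -> symdiff A B = A :|: B.
Proof.
move=> dAB; apply/setP => x; rewrite in_symdiff inE.
by case: (boolP (x \in A)) => // /(disjointFr dAB) ->.
Qed.

End SymmetricDifference.

Section CliffordAlgebra.
Variables (R : comNzRingType) (n : nat).
Implicit Types (M N P : multivector R n) (S T U : {set 'I_n}).

(* The sign of the permutation sorting the juxtaposition of S and T: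
   e_S e_T = sgn S T e_(symdiff S T), because e_i e_i = 1.                    *)
Definition sgn S T : R :=
  (-1) ^+ #|[set x : 'I_n * 'I_n | [&& x.1 \in S, x.2 \in T & (x.2 < x.1)%N]]|.

Lemma sgnE S T : sgn S T =
  \prod_(x : 'I_n * 'I_n | (x.2 < x.1)%N) (-1) ^+ ((x.1 \in S) && (x.2 \in T)).
Proof.
rewrite /sgn -prodr_const big_mkcond [RHS]big_mkcond /=.
apply: eq_bigr => x _; rewrite inE.
by case: (x.1 \in S); case: (x.2 \in T); case: (_ < _)%N.
Qed.

Lemma sgnDl S T U : sgn (symdiff S T) U = sgn S U * sgn T U.
Proof.
rewrite !sgnE -big_split; apply: eq_bigr => x _ /=; rewrite in_symdiff.
by rewrite andb_addl signr_addb.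
Qed.

Lemma sgnDr S T U : sgn S (symdiff T U) = sgn S T * sgn S U.
Proof.
rewrite !sgnE -big_split; apply: eq_bigr => x _ /=; rewrite in_symdiff.
by rewrite andb_addr signr_addb.
Qed.

Lemma sgnK S T : sgn S T * sgn S T = 1.
Proof. by rewrite -expr2 sqrr_sign. Qed.

Lemma sgn0l T : sgn finset.set0 T = 1.
Proof. by rewrite sgnE big1 // => x _; rewrite inE. Qed.

Lemma sgn0r S : sgn S finset.set0 = 1.
Proof. by rewrite sgnE big1 // => x _; rewrite inE andbF. Qed.

Definition eblade S : multivector R n := [ffun T => (T == S)%:R].

Definition vec (v : 'rV[R]_n) : multivector R n :=
  \sum_i v 0 i *: eblade [set i].

Definition geom M N : multivector R n :=
  [ffun U => \sum_S \sum_(T | symdiff S T == U) sgn S T * M S * N T].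

Definition wedge M N : multivector R n :=
  [ffun U => \sum_(S : {set 'I_n}) \sum_(T : {set 'I_n} | [disjoint S & T] && (S :|: T == U))
     sgn S T * M S * N T].

Definition reversion M : multivector R n :=
  [ffun S : {set 'I_n} => (-1) ^+ 'C(#|S|, 2) * M S].

Lemma geomE M N U :
  geom M N U = \sum_S sgn S (symdiff S U) * M S * N (symdiff S U).
Proof.
rewrite ffunE; apply: eq_bigr => S _.
by rewrite (eq_bigl (pred1 (symdiff S U))) ?big_pred1_eq // => T; exact: symdiff_eq.
Qed.

Fact geomA : associative geom.
Proof.
move=> M N P; apply/ffunP => U; rewrite !geomE.
under eq_bigr do rewrite geomE mulr_sumr.
under [RHS]eq_bigr do rewrite geomE mulr_sumr mulr_suml.
rewrite [RHS]exchange_big; apply: eq_bigr => S _ /=.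
have sdK : involutive (symdiff S) by exact: symdiffK.
rewrite (reindex_inj (inv_inj sdK)); apply: eq_bigr => K _ /=.
have -> : symdiff (symdiff S K) (symdiff S U) = symdiff K U.
  by rewrite -symdiffA [symdiff K _]symdiffA [symdiff K S]symdiffC -symdiffA symdiffK.
rewrite !(sgnDl, sgnDr) !mulrA.
transitivity ((sgn S U * sgn S U) * (sgn S S * sgn S K * sgn K K * sgn K U
   * M S * N (symdiff S K) * P (symdiff K U))); first by ring.
by rewrite sgnK; ring.
Qed.

Fact geom1l : left_id (eblade finset.set0) geom.
Proof.
move=> M; apply/ffunP => U; rewrite geomE (bigD1 finset.set0) //= big1.
  by rewrite symdiffC symdiff0 sgn0l ffunE eqxx !mul1r addr0.
by move=> S /negPf S_neq0; rewrite ffunE S_neq0 mulr0 mul0r.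
Qed.

Fact geom1r : right_id (eblade finset.set0) geom.
Proof.
move=> M; apply/ffunP => U; rewrite geomE (bigD1 U) //= big1.
  have -> : symdiff U U = finset.set0.
    by apply/setP=> x; rewrite in_symdiff inE addbb.
  by rewrite sgn0r ffunE eqxx mul1r mulr1 addr0.
move=> S S_neqU; rewrite ffunE -[_ == _]/(symdiff S U == finset.set0).
by rewrite symdiff_eq symdiff0 eq_sym (negPf S_neqU) mulr0.
Qed.

Fact geomDl : left_distributive geom +%R.
Proof.
move=> M N P; apply/ffunP => U; rewrite [RHS]ffunE !geomE -big_split.
by apply: eq_bigr => S _; rewrite /= ffunE mulrDr mulrDl.
Qed.

Fact geomDr : right_distributive geom +%R.
Proof.
move=> M N P; apply/ffunP => U; rewrite [RHS]ffunE !geomE -big_split.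
by apply: eq_bigr => S _; rewrite /= ffunE mulrDr.
Qed.

Fact eblade0_neq0 : eblade finset.set0 != 0.
Proof.
apply/eqP => /ffunP /(_ finset.set0); rewrite !ffunE eqxx.
by apply/eqP; exact: oner_neq0.
Qed.

HB.instance Definition _ := GRing.Zmodule_isNzRing.Build (multivector R n)
  geomA geom1l geom1r geomDl geomDr eblade0_neq0.

Lemma mvZE (a : R) M U : (a *: M) U = a * M U.
Proof. by rewrite ffunE. Qed.

Fact geomZl (a : R) M N : a *: (M * N) = (a *: M) * N.
Proof.
apply/ffunP => U; rewrite mvZE -[LHS]/(a * geom M N U) -[RHS]/(geom (a *: M) N U) !geomE mulr_sumr.
by apply: eq_bigr => S _; rewrite mvZE; ring.
Qed.

Fact geomZr (a : R) M N : a *: (M * N) = M * (a *: N).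
Proof.
apply/ffunP => U; rewrite mvZE -[LHS]/(a * geom M N U) -[RHS]/(geom M (a *: N) U) !geomE mulr_sumr.
by apply: eq_bigr => S _; rewrite mvZE; ring.
Qed.

HB.instance Definition _ :=
  GRing.Lmodule_isLalgebra.Build R (multivector R n) geomZl.
HB.instance Definition _ :=
  GRing.Lalgebra_isAlgebra.Build R (multivector R n) geomZr.

Lemma ebladeM S T : eblade S * eblade T = sgn S T *: eblade (symdiff S T).
Proof.
apply/ffunP => U; rewrite mvZE -[LHS]/(geom (eblade S) (eblade T) U) geomE.
rewrite (bigD1 S) //= big1 => [|V /negPf VS]; last first.
  by rewrite !ffunE VS mulr0 mul0r.
rewrite !ffunE eqxx addr0 mulr1 symdiff_eq.
by case: eqP => [->|_]; rewrite ?mulr0 // symdiffK.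
Qed.

Lemma eblade_wedge S T :
  wedge (eblade S) (eblade T) = if [disjoint S & T] then eblade S * eblade T else 0.
Proof.
apply/ffunP => U; rewrite ffunE (bigD1 S) //= [X in _ + X]big1; last first.
  by move=> V /negPf VS; rewrite big1 // => ? _; rewrite !ffunE VS mulr0 mul0r.
rewrite addr0 big_mkcond (bigD1 T) //= [X in _ + X]big1; last first.
  by move=> V /negPf VT; rewrite !ffunE VT mulr0 if_same.
rewrite !ffunE !eqxx !mulr1 addr0.
case: ifP => [/andP[dST /eqP <-]|]; last first.
  case: ifP => [dST /= |_ _]; last by rewrite ffunE.
  by rewrite ebladeM mvZE ffunE symdiff_disjoint // eq_sym => ->; rewrite mulr0.
by rewrite dST ebladeM mvZE ffunE symdiff_disjoint // eqxx mulr1.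
Qed.

Lemma wedge_suml (I J : finType) (a : I -> R) (b : J -> R)
    (E : I -> multivector R n) (F : J -> multivector R n) :
  wedge (\sum_i a i *: E i) (\sum_j b j *: F j) =
  \sum_i \sum_j (a i * b j) *: wedge (E i) (F j).
Proof.
apply/ffunP => U; rewrite ffunE.
have sumE (K : finType) (G : K -> multivector R n) V :
    (\sum_k G k) V = \sum_k G k V.
  by elim/big_ind2: _ => [|? ? ? ? <- <-|//]; rewrite ffunE.
rewrite sumE; under [RHS]eq_bigr do rewrite sumE.
under [RHS]eq_bigr do under eq_bigr do rewrite mvZE ffunE mulr_sumr.
under [RHS]eq_bigr do rewrite exchange_big /=.
rewrite [RHS]exchange_big /=; apply: eq_bigr => S _.
under [RHS]eq_bigr do under eq_bigr do rewrite mulr_sumr.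
under [RHS]eq_bigr do rewrite exchange_big /=.
rewrite [RHS]exchange_big /=; apply: eq_bigr => T _.
rewrite !sumE [sgn S T * _]mulr_sumr mulr_suml; apply: eq_bigr => i _.
by rewrite mulr_sumr; apply: eq_bigr => j _; rewrite !mvZE; ring.
Qed.

(* The defining relation vw = v.w + v /\ w of the geometric product.             *)
Lemma vecM (v w : 'rV[R]_n) :
  vec v * vec w = (v *m w^T) 0 0 *: 1 + wedge (vec v) (vec w).
Proof.
rewrite /vec wedge_suml mulr_suml mxE scaler_suml -big_split /=.
apply: eq_bigr => i _; rewrite mulr_sumr (bigD1 i) //= [in RHS](bigD1 i) //=.
rewrite addrA; congr (_ + _); last first.
  apply: eq_bigr => j ji; rewrite -geomZl -geomZr scalerA eblade_wedge.
  by rewrite disjoints1 inE eq_sym ji.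
rewrite -geomZl -geomZr scalerA eblade_wedge disjoints1 inE eqxx scaler0 addr0.
rewrite mxE ebladeM; have -> : symdiff [set i] [set i] = finset.set0.
  by apply/setP => x; rewrite in_symdiff !inE addbb.
rewrite sgnE big1 ?scale1r // => -[x y] /= yx; rewrite !inE.
by move: yx; case: eqP => [->|//]; case: eqP => [->|//]; rewrite ltnn.
Qed.

Definition mvunit : pred (multivector R n) :=
  fun M => `[< exists N, N * M = 1 /\ M * N = 1 >].

Definition mvinv M : multivector R n :=
  if pselect (exists N, N * M = 1 /\ M * N = 1) is left MV
  then projT1 (cid MV) else M.

Fact mvinvP M : M \in mvunit -> mvinv M * M = 1 /\ M * mvinv M = 1.
Proof.
by move=> /asboolP MV; rewrite /mvinv; case: pselect => // ?; case: cid.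
Qed.

Fact mulVmv : {in mvunit, left_inverse 1 mvinv *%R}.
Proof. by move=> M /mvinvP[]. Qed.

Fact mulmvV : {in mvunit, right_inverse 1 mvinv *%R}.
Proof. by move=> M /mvinvP[]. Qed.

Fact mvunitP M N : N * M = 1 /\ M * N = 1 -> mvunit M.
Proof. by move=> NM; apply/asboolP; exists N. Qed.

Fact mvinv_out : {in [predC mvunit], mvinv =1 id}.
Proof.
move=> M; rewrite inE => /asboolPn nMV; rewrite /mvinv.
by case: pselect => // /nMV.
Qed.

HB.instance Definition _ := GRing.NzRing_hasMulInverse.Build (multivector R n)
  mulVmv mulmvV mvunitP mvinv_out.

Definition dual (J M : multivector R n) : multivector R n := M * J^-1.

End CliffordAlgebra.

Section AngleBivectors.
Variables (R : realType) (n : nat).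
Local Notation X := 'rV[R]_n.
Local Notation mv := (multivector R n).
Implicit Types (A B C M Phi : mv) (V U W : {vspace X}).

Definition mvnorm M : R := Num.sqrt (\sum_S M S ^+ 2).

(* The exponential series, summed coordinatewise.                             *)
Definition mvexp M : mv :=
  [ffun S => limn (series (fun k => ((k`!%:R)^-1 *: M ^+ k) S))].

(* A is a nonzero p-blade and [A] = V.                                        *)
Definition blade_space (p : nat) A V : Prop :=
  exists v : 'I_p -> X,
    [/\ A = \big[@wedge R n/1]_(i < p) vec (v i), A != 0
      & V = <<codom v>>%VS].

Definition orthonormal_basis (p : nat) V (e : 'I_p -> X) : Prop :=
  basis_of V (codom e) /\ forall i j, dot (e i) (e j) = (i == j)%:R.

(* Only needed for dim V <= dim U, where every e_i has its principal angle.
   The ordering of the angles is left free.                                   *)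
Definition principal_bases (p q : nat) V U (e : 'I_p -> X) (u : 'I_q -> X)
    (theta : 'I_p -> R) : Prop :=
  [/\ (p <= q)%N, orthonormal_basis V e, orthonormal_basis U u,
      forall i, 0 <= theta i <= pi / 2
    & forall i j, dot (e i) (u j) = if i == j :> nat then cos (theta i) else 0].

Definition principal_bivector (e u : X) : mv :=
  if e == u then 0
  else (mvnorm (wedge (vec e) (vec u)))^-1 *: wedge (vec e) (vec u).

Definition angle_sum (p : nat) (theta : 'I_p -> R) (e u : 'I_p -> X) : mv :=
  \sum_(i < p) theta i *: principal_bivector (e i) (u i).

(* Phi = Phi_(V,U), formed with the principal basis e of V and a principal
   basis w of U whose first p vectors are u (w = u when p = q).               *)
Definition angle_bivector (p : nat) V U (e u : 'I_p -> X) Phi : Prop :=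
  exists (q : nat) (w : 'I_q -> X) (theta : 'I_p -> R),
    [/\ principal_bases V U e w theta,
        forall (i : 'I_p) (j : 'I_q), i = j :> nat -> w j = u i
      & Phi = angle_sum theta e u].

Definition blade_sign (p : nat) A (e : 'I_p -> X) (eps : R) : Prop :=
  (eps = 1 \/ eps = -1) /\ A = (eps * mvnorm A) *: \prod_(i < p) vec (e i).

(* Phi = Phi_(A,C) formed with the principal bases e of [A] and u of [C].
   An index k comes last in some common reordering of the bases making the
   angles non-decreasing iff theta k is the largest angle.
   Pitfall: if e = u every principal bivector is 0, so Phi_(A,C) = 0 even when
   A and C have opposite orientations.                                        *)
Definition oriented_angle_bivector (p : nat) A C (e u : 'I_p -> X) Phi : Prop :=
  exists (V U : {vspace X}) (theta : 'I_p -> R) (epsA epsC : R) (k : 'I_p),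
    [/\ blade_space p A V /\ blade_space p C U, principal_bases V U e u theta,
        blade_sign A e epsA /\ blade_sign C u epsC,
        forall i, theta i <= theta k
      & Phi = if epsA * epsC == 1 then angle_sum theta e u
              else angle_sum theta e u - pi *: principal_bivector (e k) (u k)].

End AngleBivectors.

(* Main.v *)
(* In the plane of [e_i] and [f_i] the bivector [I_i] is a rotation by a right
   angle: [I_i ^+ 2 = -1], and the [I_i] commute since these planes are mutually
   orthogonal.  Hence [exp (sum a_i I_i) = prod (cos a_i + sin a_i I_i)] and
   [J^-1 = prod (- I_i)], so that dualising replaces every [a_i] by
   [a_i - pi / 2]; on the other side the bivector of [e_i] and [eperp_i] is
   [- I_i] (or both vectors coincide and the angle is [0]).  For the oriented
   version, adding [pi I_k] or [- pi I_k] changes the sign of the exponential, and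
   [f_1 ... f_p J^-1 = eperp_1 ... eperp_p], so that [B] and its dual have the same
   sign relative to their principal bases. *)
Require Import Defs.
From HB Require Import structures.
From mathcomp Require Import all_boot all_order all_algebra.
From mathcomp Require Import all_classical all_reals all_analysis.
From mathcomp Require Import ring lra.
Import numFieldNormedType.Exports.

Set Implicit Arguments.
Unset Strict Implicit.
Unset Printing Implicit Defensive.

Import Order.TTheory GRing.Theory Num.Theory.
Local Open Scope ring_scope.

(** * Clifford products with vectors *)

Section Clifford.
Variables (R : comNzRingType) (n : nat).
Implicit Types (M N : multivector R n) (S T U : {set 'I_n}) (v w : 'rV[R]_n).

Lemma mv_eblade M : M = \sum_S M S *: eblade R S.
Proof.
apply/ffunP => U; rewrite sum_ffunE (bigD1 U) //= big1 => [|S SU].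
  by rewrite !ffunE eqxx addr0 [RHS]mulr1.
by rewrite !ffunE eq_sym (negPf SU) [LHS]mulr0.
Qed.

(** Supplies the sign [(-1) ^+ k] needed to write the wedge of a vector with a k-vector in terms of
    geometric products. *)
Definition grade_involution M : multivector R n :=
  [ffun S : {set 'I_n} => (-1) ^+ #|S| * M S].

Lemma grade_involution_is_linear : linear grade_involution.
Proof. move=> a M N; apply/ffunP => S.
by rewrite [LHS]ffunE [RHS]ffunE mvZE !ffunE mulrDr; congr (_ + _); exact: mulrCA.
Qed.

HB.instance Definition _ := GRing.isLinear.Build R (multivector R n)
  (multivector R n) _ grade_involution grade_involution_is_linear.

Lemma signr_card S : (-1) ^+ #|S| = \prod_(i : 'I_n) (-1) ^+ (i \in S) :> R.
Proof.
by rewrite -prodr_const big_mkcond; apply: eq_bigr => i _ /=; case: (i \in S).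
Qed.

Lemma signr_symdiff S T :
  (-1) ^+ #|symdiff S T| = (-1) ^+ #|S| * (-1) ^+ #|T| :> R.
Proof.
rewrite !signr_card -big_split; apply: eq_bigr => i _ /=.
by rewrite in_symdiff signr_addb.
Qed.

Lemma grade_involutionM M N :
  grade_involution (M * N) = grade_involution M * grade_involution N.
Proof.
apply/ffunP => U; rewrite ffunE -[(M * N) U]/(geom M N U) -[RHS]/(geom _ _ U).
rewrite !geomE mulr_sumr; apply: eq_bigr => S _; rewrite !ffunE.
rewrite [(-1) ^+ #|symdiff S U|]signr_symdiff.
set x := (-1) ^+ #|S|; set u := (-1) ^+ #|U|; set y := sgn _ _ _.
transitivity (x ^+ 2 * (u * (y * M S * N (symdiff S U)))); last by ring.
by rewrite sqrr_sign mul1r.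
Qed.

Lemma grade_involution1 : grade_involution 1 = 1.
Proof.
apply/ffunP => U; rewrite !ffunE; case: eqP => [->|_]; last by rewrite mulr0.
by rewrite cards0 mul1r.
Qed.

HB.instance Definition _ := GRing.isMonoidMorphism.Build (multivector R n)
  (multivector R n) grade_involution (conj grade_involution1 grade_involutionM).

Lemma vec_is_linear : linear (@vec R n).
Proof.
move=> a v w; rewrite /vec scaler_sumr -big_split; apply: eq_bigr => i _ /=.
by rewrite !mxE scalerDl scalerA.
Qed.

HB.instance Definition _ := GRing.isLinear.Build R 'rV[R]_n
  (multivector R n) _ (@vec R n) vec_is_linear.

Lemma vecZ a v : vec (a *: v) = a *: vec v. Proof. exact: linearZ. Qed.

Lemma vecB v w : vec (v - w) = vec v - vec w. Proof. exact: linearB. Qed.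

Lemma vec_set1 v i : vec v [set i] = v 0 i.
Proof.
rewrite /vec sum_ffunE (bigD1 i) //= big1 => [|j ji].
  by rewrite !ffunE eqxx addr0 [LHS]mulr1.
by rewrite !ffunE [_ == _](inj_eq set1_inj) eq_sym (negPf ji) [LHS]mulr0.
Qed.

Lemma vec_inj : injective (@vec R n).
Proof.
by move=> v w vw; apply/rowP => i; rewrite -!vec_set1 vw.
Qed.

Lemma grade_involution_eblade S :
  grade_involution (eblade R S) = (-1) ^+ #|S| *: eblade R S.
Proof.
by apply/ffunP => T; rewrite mvZE !ffunE; case: eqP => [->|_] //; rewrite !mulr0.
Qed.

Lemma grade_involution_vec v : grade_involution (vec v) = - vec v.
Proof.
rewrite /vec linear_sum -sumrN; apply: eq_bigr => i _.
by rewrite linearZ /= grade_involution_eblade cards1 expr1 scaleN1r scalerN.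
Qed.

(** [sgn R S [set i]] counts the elements of [S] above [i], and [sgn R [set i] S] those below;
    together they account for [S :\ i]. *)
Lemma sgn_set1C i S : sgn R S [set i] = (-1) ^+ #|S :\ i| * sgn R [set i] S.
Proof.
have sl : sgn R [set i] S = \prod_(j : 'I_n) (-1) ^+ ((j \in S) && (j < i)%N).
  rewrite sgnE big_mkcond -(pair_big xpredT xpredT
    (fun x y : 'I_n =>
       if (y < x)%N then (-1) ^+ ((x \in [set i]) && (y \in S)) else 1 : R)) /=.
  rewrite (bigD1 i) //= [X in _ * X]big1 => [|x xi].
    rewrite mulr1; apply: eq_bigr => y _; rewrite inE eqxx /=.
    by case: (y < i)%N; rewrite ?andbT ?andbF.
  by rewrite big1 // => y _; rewrite inE (negPf xi) /= if_same.
have sr : sgn R S [set i] = \prod_(j : 'I_n) (-1) ^+ ((j \in S) && (i < j)%N).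
  rewrite sgnE big_mkcond -(pair_big xpredT xpredT
    (fun x y : 'I_n =>
       if (y < x)%N then (-1) ^+ ((x \in S) && (y \in [set i])) else 1 : R)) /=.
  apply: eq_bigr => x _; rewrite (bigD1 i) //= big1 => [|y yi].
    by rewrite mulr1 inE eqxx andbT; case: (i < x)%N; rewrite ?andbT ?andbF.
  by rewrite inE (negPf yi) andbF if_same.
rewrite sl sr signr_card -big_split; apply: eq_bigr => j _ /=; rewrite !inE.
rewrite -val_eqE /=; case: (j \in S); rewrite /= ?andbF ?mul1r //.
by case: (ltngtP j i); rewrite /= ?mulr1 ?mul1r -?expr2 ?sqrrN ?expr1n ?expr0 ?expr1.
Qed.

(** On [e_i] and [e_S] the two products on the right cancel if [i] lies in [S] and agree otherwise.
    Doubling avoids a division by 2 in the ring [R]. *)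
Lemma wedge_vec v M :
  wedge (vec v) M *+ 2 = vec v * M + grade_involution M * vec v.
Proof.
rewrite {1 2 3}[M]mv_eblade /vec wedge_suml mulr_suml mulr_sumr -sumrMnl.
rewrite -big_split; apply: eq_bigr => i _ /=.
rewrite linear_sum mulr_suml mulr_sumr -sumrMnl -big_split.
apply: eq_bigr => S _ /=.
rewrite linearZ /= grade_involution_eblade eblade_wedge disjoints1.
rewrite -!scalerAr -!scalerAl !scalerA !ebladeM [symdiff S _]symdiffC !scalerA.
rewrite sgn_set1C -scalerDl.
have [iS|iS] := boolP (i \in S).
  rewrite (cardsD1 i S) iS scaler0 mul0rn add1n exprS.
  set x := (-1) ^+ _; set y := sgn _ _ _.
  have -> : M S * v 0 i * y + v 0 i * (M S * (-1 * x)) * (x * y)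
    = v 0 i * M S * y * (1 - x ^+ 2) by ring.
  by rewrite sqrr_sign subrr mulr0 scale0r.
have -> : S :\ i = S.
  apply/setP => j; rewrite !inE; case: eqP => // -> /=.
  by rewrite (negPf iS).
set x := (-1) ^+ _; set y := sgn _ _ _; rewrite /= scalerA scalerMnl.
congr (_ *: _).
have -> : M S * v 0 i * y + v 0 i * (M S * x) * (x * y)
    = v 0 i * M S * y * (1 + x ^+ 2) by ring.
by rewrite sqrr_sign; ring.
Qed.

Lemma wedge_vecE v w :
  wedge (vec v) (vec w) = vec v * vec w - (v *m w^T) 0 0 *: 1.
Proof. by rewrite vecM addrC addKr. Qed.

(** The case [M = vec w] of [wedge_vec], with the wedge eliminated by [vecM]. *)
Lemma vec_anticomm v w : vec v * vec w + vec w * vec v = (v *m w^T) 0 0 *+ 2 *: 1.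
Proof.
have := wedge_vec v (vec w); rewrite grade_involution_vec wedge_vecE mulNr.
rewrite mulrnBl scalerMnl => /eqP; rewrite subr_eq => /eqP.
rewrite [X in X = _ -> _]mulr2n -addrA => /addrI ->.
by rewrite addrAC addNr add0r.
Qed.

Lemma vecMC_ortho v w : (v *m w^T) 0 0 = 0 -> vec v * vec w = - (vec w * vec v).
Proof.
by move=> vw0; apply/eqP; rewrite -addr_eq0 vec_anticomm vw0 mul0rn scale0r.
Qed.

Lemma vec_prod_ortho (p : nat) v (w : 'I_p -> 'rV[R]_n) :
  (forall i, (v *m (w i)^T) 0 0 = 0) ->
  vec v * \prod_(i < p) vec (w i) = (-1) ^+ p * (\prod_(i < p) vec (w i) * vec v).
Proof.
elim: p w => [|p IHp] w vw; first by rewrite big_ord0 mulr1 !mul1r.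
rewrite big_ord_recl mulrA vecMC_ortho // mulNr -[in LHS]mulrA IHp //.
rewrite [in RHS]exprS mulN1r mulNr -!mulrA [in LHS]mulrA.
by rewrite commr_sign !mulrA.
Qed.

End Clifford.

(** * Norms and wedge products over the reals *)

Section EuclideanClifford.
Variables (R : realType) (n : nat).
Implicit Types (M N : multivector R n) (S T U : {set 'I_n}) (v w : 'rV[R]_n).

Lemma mv_mul2n_inj : injective (fun M => M *+ 2).
Proof.
move=> M N /ffunP MN; apply/ffunP => S; have := MN S.
by rewrite !ffunMnE => /eqP; rewrite eqr_pMn2r // => /eqP.
Qed.

Lemma vec_sqr v : vec v * vec v = dot v v *: 1.
Proof. by apply: mv_mul2n_inj; rewrite mulr2n vec_anticomm scalerMnl. Qed.

(** The sign that the grade involution puts on p vectors is undone by moving [vec v] through them,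
    so both terms of [wedge_vec] coincide. *)
Lemma wedge_vec_prod (p : nat) v (w : 'I_p -> 'rV[R]_n) :
  (forall i, dot v (w i) = 0) ->
  wedge (vec v) (\prod_(i < p) vec (w i)) = vec v * \prod_(i < p) vec (w i).
Proof.
move=> vw; apply: mv_mul2n_inj; rewrite wedge_vec rmorph_prod.
rewrite [in X in _ + X](eq_bigr (fun i => - vec (w i))) => [|i _]; last first.
  exact: grade_involution_vec.
by rewrite prodrN card_ord -mulrA -vec_prod_ortho // mulr2n.
Qed.

Lemma big_wedge_ortho (p : nat) (w : 'I_p -> 'rV[R]_n) :
  (forall i j, i != j -> dot (w i) (w j) = 0) ->
  \big[@wedge R n/1]_(i < p) vec (w i) = \prod_(i < p) vec (w i).
Proof.
elim: p w => [|p IHp] w ww; first by rewrite !big_ord0.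
rewrite !big_ord_recl IHp => [|i j ij]; last first.
  by rewrite ww // (inj_eq (@lift_inj _ _)).
by rewrite wedge_vec_prod // => i; rewrite ww.
Qed.

Definition mvdot M N : R := \sum_S M S * N S.

(** Left multiplication by [e_i] is a signed permutation of the basis blades, and a symmetric one:
    since [e_i e_i = 1], going from [U] to its symmetric difference with [i] and back carries the
    same sign twice. *)
Lemma mvdot_vecM v M N : mvdot (vec v * M) N = mvdot M (vec v * N).
Proof.
rewrite /mvdot /vec !mulr_suml.
under eq_bigr do rewrite sum_ffunE mulr_suml.
under [RHS]eq_bigr do rewrite sum_ffunE mulr_sumr.
rewrite exchange_big [RHS]exchange_big; apply: eq_bigr => i _ /=.
have eiE P U : (eblade R [set i] * P) U =
    sgn R [set i] (symdiff [set i] U) * P (symdiff [set i] U).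
  rewrite -[LHS]/(geom _ _ U) geomE (bigD1 [set i]) //= big1 => [|S /negPf Si].
    by rewrite ffunE eqxx mulr1 addr0.
  by rewrite ffunE Si mulr0 mul0r.
have sdK : involutive (symdiff [set i]) by exact: symdiffK.
rewrite (reindex_inj (inv_inj sdK)); apply: eq_bigr => U _ /=.
rewrite -!scalerAl !mvZE !eiE symdiffK.
suff -> : sgn R [set i] (symdiff [set i] U) = sgn R [set i] U by ring.
rewrite sgnDr (_ : sgn R [set i] [set i] = 1) ?mul1r //.
rewrite sgnE big1 // => -[x y] /= yx; rewrite !inE.
by move: yx; case: eqP => [->|//]; case: eqP => [->|//]; rewrite ltnn.
Qed.

Lemma mvnormE M : mvnorm M = Num.sqrt (mvdot M M).
Proof. by congr Num.sqrt; apply: eq_bigr => S _; rewrite expr2. Qed.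

Lemma mvnormZ a M : mvnorm (a *: M) = `|a| * mvnorm M.
Proof.
rewrite !mvnormE -sqrtr_sqr -sqrtrM ?sqr_ge0 //; congr Num.sqrt.
by rewrite /mvdot mulr_sumr; apply: eq_bigr => S _; rewrite mvZE; ring.
Qed.

(** Moving [vec v] to the other side of the inner product produces [vec v * vec v], which is a
    scalar. *)
Lemma mvnorm_vecM v M : mvnorm (vec v * M) = Num.sqrt (dot v v) * mvnorm M.
Proof.
rewrite !mvnormE mvdot_vecM mulrA vec_sqr -sqrtrM.
  congr Num.sqrt; rewrite /mvdot mulr_sumr; apply: eq_bigr => S _.
  by rewrite -scalerAl mul1r mvZE; ring.
by rewrite dotE sumr_ge0 // => i _; rewrite -expr2 sqr_ge0.
Qed.

Lemma mvnorm1 : mvnorm (1 : multivector R n) = 1.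
Proof.
rewrite /mvnorm (bigD1 finset.set0) //= big1 => [|S /negPf S0].
  by rewrite ffunE eqxx addr0 expr1n sqrtr1.
by rewrite ffunE S0 expr0n.
Qed.

Lemma mvnorm_prod_unit (p : nat) (w : 'I_p -> 'rV[R]_n) :
  (forall i, dot (w i) (w i) = 1) -> mvnorm (\prod_(i < p) vec (w i)) = 1.
Proof.
elim: p w => [|p IHp] w ww; first by rewrite big_ord0 mvnorm1.
by rewrite big_ord_recl mvnorm_vecM ww sqrtr1 mul1r IHp.
Qed.

(** For a unit vector [v] the wedge is the geometric product of [v] with the component of [w]
    orthogonal to [v], so norms multiply. *)
Lemma mvnorm_wedge_unit v w : dot v v = 1 ->
  mvnorm (wedge (vec v) (vec w)) = Num.sqrt (dot w w - dot v w ^+ 2).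
Proof.
move=> vv; have -> : wedge (vec v) (vec w) = vec v * (vec (w - dot v w *: v) * 1).
  rewrite mulr1 vecB vecZ mulrBr -geomZr vec_sqr vv scale1r.
  exact: wedge_vecE.
rewrite !mvnorm_vecM vv sqrtr1 mul1r mvnorm1 mulr1; congr Num.sqrt.
rewrite linearBl !linearBr !linearZl_LR !linearZr_LR /= vv [dot w v]dotC; ring.
Qed.

(** Only two-element index sets occur in the wedge of two vectors, and there reversion has the sign
    [(-1) ^+ 'C(2, 2)]. *)
Lemma reversion_wedge_vec v w :
  reversion (wedge (vec v) (vec w)) = - wedge (vec v) (vec w).
Proof.
apply/ffunP => U; rewrite !ffunE.
have [U2|U2] := eqVneq #|U| 2%N; first by rewrite U2 mulN1r.
rewrite big1 ?mulr0 ?oppr0 // => S _; rewrite big1 // => T /andP[dST /eqP ST].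
suff : (#|S| != 1%N) || (#|T| != 1%N).
  have vec0 x (V : {set 'I_n}) : #|V| != 1%N -> vec x V = 0 :> R.
    move=> V1; rewrite /vec sum_ffunE big1 // => i _; rewrite mvZE ffunE.
    have [VE|_] := eqVneq V [set i]; last by rewrite mulr0.
    by rewrite VE cards1 in V1.
  by case/orP => /vec0 ->; rewrite ?mulr0 ?mul0r.
rewrite -negb_and; apply: contra U2 => /andP[/eqP S1 /eqP T1].
by rewrite -ST cardsU (disjoint_setI0 dST) cards0 S1 T1.
Qed.

End EuclideanClifford.

(** * Exponentials of commuting bivectors *)

Section Exponential.
Local Open Scope classical_set_scope.
Variables (R : realType) (n : nat).
Implicit Types (I J K L M N Q : multivector R n).

(** The exponential series of [M] applied to [Q]. Carrying [Q] along allows it to be split into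
    parts on which [M] acts simply; [Q = 1] gives back [mvexp M]. *)
Definition exp_cvg M Q L : Prop := forall S,
  series (fun k => ((k`!%:R)^-1 *: (M ^+ k * Q)) S) @ \oo --> L S.

Lemma exp_cvgE M L : exp_cvg M 1 L -> mvexp M = L.
Proof.
move=> ML; apply/ffunP => S; rewrite ffunE; apply: cvg_lim => //.
by under eq_fun do rewrite -[M ^+ _]mulr1; exact: ML.
Qed.

Lemma exp_cvgD M Q L Q' L' :
  exp_cvg M Q L -> exp_cvg M Q' L' -> exp_cvg M (Q + Q') (L + L').
Proof.
move=> MQ MQ' S; rewrite ffunE; apply: cvg_trans (cvgD (MQ S) (MQ' S)).
apply: near_eq_cvg; apply: nearW => k /=; rewrite fctE /series /= -big_split.
by apply: eq_bigr => i _; rewrite /= mulrDr scalerDr [RHS]ffunE.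
Qed.

(** On [Q] the element [M] acts as [b I], with [I] in the role of the imaginary unit: [M ^+ k * Q]
    is alternately a multiple of [Q] and of [I * Q], and the two halves of the series are those of
    [cos b] and [sin b]. *)
Lemma exp_cvg_eigen I M Q (b : R) : I * I = -1 -> GRing.comm M I ->
  M * Q = b *: (I * Q) -> exp_cvg M Q ((cos b *: 1 + sin b *: I) * Q).
Proof.
move=> II MI MQ S.
have MkQ k : (k`!%:R)^-1 *: (M ^+ k * Q) =
    cos_coeff b k *: Q + sin_coeff b k *: (I * Q).
  have MIQ : M * (I * Q) = - b *: Q.
    by rewrite mulrA MI -mulrA MQ -geomZr mulrA II mulN1r scalerN scaleNr.
  suff -> : M ^+ k * Q =
      ((~~ odd k)%:R * (-1) ^+ k./2 * b ^+ k) *: Q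
      + ((odd k)%:R * (-1) ^+ k.-1./2 * b ^+ k) *: (I * Q).
    rewrite scalerDr !scalerA /cos_coeff /sin_coeff /=.
    by congr (_ *: _ + _ *: _); rewrite mulrC.
  elim: k => [|k IHk]; first by rewrite !mul1r !mul0r scale0r addr0 scale1r.
  rewrite exprS -mulrA IHk mulrDr -!geomZr MQ MIQ !scalerA addrC.
  congr (_ *: _ + _ *: _); rewrite /= ?negbK exprS; last first.
    by rewrite [_ * b]mulrC; case: (odd k) => /=; ring.
  rewrite uphalf_half; case: k {IHk} => [|k] /=; first by rewrite !mul0r.
  rewrite ?negbK uphalf_half; case: (odd k) => /=; first by rewrite !mul0r.
  by rewrite add1n add0n [(-1) ^+ _.+1]exprS; ring.
have cosb : series (cos_coeff b) @ \oo --> cos b.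
  by rewrite unlock; exact: is_cvg_series_cos_coeff.
have sinb : series (sin_coeff b) @ \oo --> sin b.
  by rewrite unlock; exact: is_cvg_series_sin_coeff.
rewrite mulrDl -!geomZl mul1r ffunE !mvZE.
apply: cvg_trans (cvgD (cvgMr_tmp (b := Q S) cosb) (cvgMr_tmp (b := (I * Q) S) sinb)).
apply: near_eq_cvg; apply: nearW => k /=; rewrite fctE /series /= !mulr_suml -big_split.
by apply: eq_bigr => i _; rewrite MkQ [RHS]ffunE !mvZE.
Qed.

(* Where an eigenvalue equation [M0 Q = b I Q] holds, each new term [a_j I_j] is
   diagonalised by splitting Q along the two eigenspaces of the involution
   [- I I_j], on which [I_j] acts as [I] or as [- I]. *)
Lemma exp_cvg_sum (T : eqType) (s : seq T) I (a : T -> R)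
    (K : T -> multivector R n) M Q (b : R) :
  I * I = -1 -> {in s, forall i, K i * K i = -1} ->
  {in s, forall i, GRing.comm I (K i)} ->
  {in s &, forall i j, GRing.comm (K i) (K j)} ->
  GRing.comm M I -> {in s, forall i, GRing.comm M (K i)} ->
  M * Q = b *: (I * Q) ->
  exp_cvg (M + \sum_(i <- s) a i *: K i) Q
    ((cos b *: 1 + sin b *: I) *
      (\prod_(i <- s) (cos (a i) *: 1 + sin (a i) *: K i) * Q)).
Proof.
move=> II; elim: s M Q b => [|j s IHs] M Q b KK IK KKC MI MK MQ.
  by rewrite !big_nil addr0 mul1r; exact: exp_cvg_eigen.
have sub i : i \in s -> i \in j :: s by rewrite inE orbC => ->.
have j_in : j \in j :: s by rewrite inE eqxx.
have KjKj := KK j j_in; have IKj : I * K j = K j * I := IK j j_in.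
have MKj : M * K j = K j * M := MK j j_in; have MIE : M * I = I * M := MI.
set P := \prod_(i <- s) (cos (a i) *: 1 + sin (a i) *: K i).
have KjP : GRing.comm (K j) P.
  rewrite /P big_seq; apply: commr_prod => i i_in.
  apply: commrD; rewrite /GRing.comm -geomZr -geomZl ?mulr1 ?mul1r //.
  by rewrite (KKC j i) // sub.
have IP : GRing.comm I P.
  rewrite /P big_seq; apply: commr_prod => i i_in.
  apply: commrD; rewrite /GRing.comm -geomZr -geomZl ?mulr1 ?mul1r //.
  by rewrite IK // sub.
have KjPE : K j * P = P * K j := KjP; have IPE : I * P = P * I := IP.
rewrite !big_cons addrA.
pose half e := 2^-1 *: (Q - e *: (I * K j * Q)).
have half_cvg (e : R) : e ^+ 2 = 1 ->
    exp_cvg (M + a j *: K j + \sum_(i <- s) a i *: K i) (half e)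
    ((cos b *: 1 + sin b *: I) * ((cos (a j) *: 1 + sin (a j) *: K j) * P * half e)).
  move=> e2.
  have Khalf : K j * half e = e *: (I * half e).
    rewrite /half -!geomZr !mulrBr -!geomZr !mulrA -IKj -[I * K j * K j]mulrA.
    rewrite KjKj II mulrN1 mulN1r !mulNr !scalerN !opprK !scalerDr !scalerA.
    by rewrite [_ * 2^-1 * e]mulrAC -expr2 e2 mul1r addrC [e * 2^-1]mulrC.
  have Mhalf : M * half e = b *: (I * half e).
    rewrite /half -!geomZr !mulrBr -!geomZr !mulrA II MIE -[I * M * K j]mulrA.
    rewrite MKj -!mulrA MQ -!geomZr !mulrA IKj -[K j * I * I]mulrA.
    rewrite II mulN1r mulrN1 !mulNr.
    by rewrite !scalerN !opprK !scalerDr !scalerA; congr (_ *: _ + _ *: _); ring.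
  (* Where [K j] acts as [e *: I], the factors for [b] and [a j] merge by the addition formulas; the
     parities of cosine and sine absorb the sign [e]. *)
  have -> : (cos b *: 1 + sin b *: I) *
      ((cos (a j) *: 1 + sin (a j) *: K j) * P * half e) =
      (cos (b + e * a j) *: 1 + sin (b + e * a j) *: I) * (P * half e).
    have [cosE sinE] : cos (e * a j) = cos (a j) /\ sin (e * a j) = e * sin (a j).
      by move/eqP: e2; rewrite sqrf_eq1 => /orP[] /eqP ->;
        rewrite ?mulN1r ?mul1r ?cosN ?sinN.
    have KY : K j * (P * half e) = e *: (I * (P * half e)).
      by rewrite mulrA KjPE -mulrA Khalf -geomZr !mulrA IPE.
    rewrite -[_ * P * _]mulrA; move: (P * half e) KY => Y KY.
    rewrite !mulrDl !mulrDr -!geomZl -!geomZr !mul1r KY -!geomZr !mulrA II mulN1r.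
    rewrite !scalerN !scalerA cosD sinD cosE sinE.
    rewrite -[- (_ *: Y)]scaleNr [X in _ + X = _]addrC addrACA -!scalerDl.

    by congr (_ *: _ + _ *: _); ring.
  (* The new operator is [M + a j *: K j]; on [half e] it acts as [(b + e * a j) *: I]. *)
  apply: IHs.
  - by move=> i /sub; exact: KK.
  - by move=> i /sub; exact: IK.
  - by move=> i k /sub i_in /sub; exact: KKC.
  - apply: commr_sym; apply: commrD; first exact: commr_sym.
    by rewrite /GRing.comm -geomZr -geomZl IKj.
  - move=> i /sub i_in; apply: commr_sym; apply: commrD; first exact/commr_sym/MK.
    by rewrite /GRing.comm -geomZr -geomZl KKC.
  by rewrite mulrDl -geomZl Khalf Mhalf scalerA [_ * e]mulrC -scalerDl.
have QE : Q = half 1 + half (-1).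
  rewrite /half scaleN1r opprK scale1r -scalerDr addrACA addNr addr0 -mulr2n.
  by rewrite -scalerMnr scalerMnl -mulr_natr mulVf ?scale1r // pnatr_eq0.
rewrite [X in exp_cvg _ X _]QE [X in exp_cvg _ _ (_ * (_ * X))]QE !mulrDr.
by apply: exp_cvgD; apply: half_cvg; rewrite ?sqrrN expr1n.
Qed.

Lemma mvexp_sum (p : nat) (a : 'I_p -> R) (K : 'I_p -> multivector R n) :
  (0 < p)%N -> (forall i, K i * K i = -1) ->
  (forall i j, K i * K j = K j * K i) ->
  mvexp (\sum_(i < p) a i *: K i) = \prod_(i < p) (cos (a i) *: 1 + sin (a i) *: K i).
Proof.
case: p a K => // p a K _ KK KC; apply: exp_cvgE.
(* The induction starts from [M = 0], [Q = 1] and [b = 0]. Any square root of -1 commuting with all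
   [K i] can serve as [I]; [K ord0] is one. *)
have := @exp_cvg_sum _ (index_enum 'I_p.+1) (K ord0) a K 0 1 0.
rewrite add0r cos0 sin0 !(scale0r, scale1r, addr0, mul1r, mulr1, mul0r).
by apply=> //; [exact: commr_sym (commr0 _) | move=> i _; exact: commr_sym (commr0 _)].
Qed.

End Exponential.

(** * Orthonormal families *)

Section OrthonormalFamilies.
Variables (R : realType) (n : nat).
Implicit Types (u v : 'rV[R]_n) (U V W : {vspace 'rV[R]_n}).

Definition orthonormal_family (p : nat) (e : 'I_p -> 'rV[R]_n) : Prop :=
  forall i j, dot (e i) (e j) = (i == j)%:R.

Lemma mem_codom_span (p : nat) (e : 'I_p -> 'rV[R]_n) i : e i \in <<codom e>>%VS.
Proof. by apply: memv_span; exact: codom_f. Qed.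

Lemma codom_span_subv (p : nat) (e : 'I_p -> 'rV[R]_n) U :
  (forall i, e i \in U) -> (<<codom e>> <= U)%VS.
Proof. by move=> eU; apply/span_subvP => _ /codomP[i ->]. Qed.

Lemma orthonormal_family_free (p : nat) (e : 'I_p -> 'rV[R]_n) :
  orthonormal_family e -> free (codom e).
Proof.
move=> ee.
have -> : codom e = [tuple e i | i < p] by rewrite codomE.
apply/freeP => k k0 i; have := congr1 (dot (e i)) k0.
rewrite linear0r linear_sumr (bigD1 i) //= big1 => [|j ji].
  by rewrite linearZr_LR /= nth_mktuple ee eqxx mulr1 addr0.
by rewrite linearZr_LR /= nth_mktuple ee eq_sym (negPf ji) mulr0.
Qed.

Lemma dim_orthonormal_family (p : nat) (e : 'I_p -> 'rV[R]_n) :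
  orthonormal_family e -> \dim <<codom e>> = p.
Proof. by move=> /orthonormal_family_free/eqP ->; rewrite size_codom card_ord. Qed.

(** Gram-Schmidt, by induction on the number [\dim U - p] of missing vectors. It serves to complete
    the vectors [eperp i] to a basis of the complement of [W]. *)
Lemma orthonormal_family_extend U (p : nat) (e : 'I_p -> 'rV[R]_n) :
  orthonormal_family e -> (forall i, e i \in U) ->
  exists (q : nat) (w : 'I_q -> 'rV[R]_n),
    [/\ (p <= q)%N, orthonormal_basis U w
      & forall (i : 'I_p) (j : 'I_q), i = j :> nat -> w j = e i].
Proof.
have [k] := ubnP (\dim U - p); elim: k => // k IHk in p e *.
move=> dimU ee eU.
have [Ue|/subvPn[x xU xe]] := boolP (U <= <<codom e>>)%VS.
  exists p, e; split=> // [|i j /val_inj -> //].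
  split=> //; rewrite basisEfree orthonormal_family_free //=.
  by rewrite codom_span_subv //= size_codom card_ord -(dim_orthonormal_family ee) dimvS.
pose y0 := x - \sum_i dot x (e i) *: e i.
have y0U : y0 \in U by rewrite rpredB // rpred_sum // => i _; rewrite rpredZ.
have y0_neq0 : y0 != 0.
  apply: contraNneq xe => /eqP; rewrite subr_eq0 => /eqP ->.
  by rewrite rpred_sum // => i _; rewrite rpredZ // mem_codom_span.
have y0e j : dot y0 (e j) = 0.
  rewrite linearBl linear_sumlz (bigD1 j) //= big1 => [|i ij].
    by rewrite linearZl_LR /= ee eqxx mulr1 addr0 subrr.
  by rewrite linearZl_LR /= ee (negPf ij) mulr0.
have y00 := dot_gt0 y0_neq0.
pose y := (Num.sqrt (dot y0 y0))^-1 *: y0.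
have yy : dot y y = 1.
  rewrite linearZl_LR linearZr_LR /= mulrA -expr2 exprVn sqr_sqrtr ?ltW //.
  by rewrite mulVf // gt_eqF.
have ye j : dot y (e j) = 0 by rewrite linearZl_LR /= y0e mulr0.
(* The new vector gets the last index, so that the old vectors keep the numerical values of their
   indices. *)
pose e' (i : 'I_p.+1) := if unlift ord_max i is Some j then e j else y.
have e'e' : orthonormal_family e'.
  move=> i j; rewrite /e'.
  case: unliftP => [i' ->|->]; case: unliftP => [j' ->|->].
  - by rewrite ee (inj_eq (@lift_inj _ _)).
  - by rewrite dotC ye eq_sym (negPf (neq_lift _ _)).
  - by rewrite ye (negPf (neq_lift _ _)).
  - by rewrite yy eqxx.
have e'U i : e' i \in U.
  by rewrite /e'; case: unliftP => [j _|_]; rewrite ?eU // rpredZ.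
have lepU : (p < \dim U)%N.
  rewrite -(dim_orthonormal_family e'e'); exact/dimvS/codom_span_subv.
have [|q [w [pq wU we']]] := IHk _ e' _ e'e' e'U.
  by rewrite -ltnS (leq_trans _ dimU) // ltnS subnS prednK // subn_gt0.
exists q, w; split=> [|//|i j ij]; first exact: ltnW.
rewrite (we' (lift ord_max i)) ?lift_max // /e'.
by rewrite liftK.
Qed.

Lemma orthonormal_family_basis (p : nat) (e : 'I_p -> 'rV[R]_n) :
  orthonormal_family e -> orthonormal_basis <<codom e>>%VS e.
Proof.
by move=> ee; split=> //; rewrite basisEfree orthonormal_family_free //= subvv /=
  size_codom card_ord dim_orthonormal_family.
Qed.

End OrthonormalFamilies.

(** * Principal planes *)

Section PrincipalPlanes.
Variables (R : realType) (n : nat).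
Implicit Types (M N A : multivector R n) (u v w : 'rV[R]_n).

(** Collecting the [x i] on the left moves [x i] only past [y j] with [j < i]. This covers pairs
    that do not commute at equal indices, such as [vec (f i)] and [I_i]. *)
Lemma prodrM_comm_neq (S : pzRingType) (p : nat) (x y : 'I_p -> S) :
  (forall i j, i != j -> GRing.comm (x i) (y j)) ->
  \prod_(i < p) (x i * y i) = \prod_(i < p) x i * \prod_(i < p) y i.
Proof.
elim: p x y => [|p IHp] x y xy; first by rewrite !big_ord0 mulr1.
rewrite !big_ord_recl IHp => [|i j ij]; last first.
  by apply: xy; rewrite (inj_eq (@lift_inj _ _)).
rewrite -!mulrA; congr (_ * _); rewrite !mulrA; congr (_ * _).
by apply: commr_prod => i _; apply/commr_sym/xy; rewrite eq_sym neq_lift.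
Qed.

Lemma prod_quasicomm (p : nat) M (N : 'I_p -> multivector R n) (s : 'I_p -> R) :
  (forall i, M * N i = s i *: (N i * M)) ->
  M * \prod_(i < p) N i = (\prod_(i < p) s i) *: (\prod_(i < p) N i * M).
Proof.
elim: p N s => [|p IHp] N s MN; first by rewrite !big_ord0 mulr1 mul1r scale1r.
rewrite !big_ord_recl mulrA MN -geomZl -mulrA (IHp _ (fun i => s (lift ord0 i))) //.
by rewrite -geomZr scalerA mulrA.
Qed.

Lemma vecMC v w : vec v * vec w = (dot v w *+ 2) *: 1 - vec w * vec v.
Proof. by rewrite -vec_anticomm addrK. Qed.

Lemma mvnorm_neq0 M : mvnorm M = 1 -> M != 0.
Proof.
move=> M1; apply/eqP => M0; move/eqP: M1; rewrite M0.
rewrite -[X in mvnorm X](scale0r (0 : multivector R n)) mvnormZ normr0 mul0r.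
by rewrite eq_sym oner_eq0.
Qed.

(** The wedge of two unit vectors at angle [t] has norm [sin t], so the factor [sin t] undoes the
    normalisation; [sin t != 0] rules out [u = v]. *)
Lemma sin_principal_bivector u v (t : R) :
  dot u u = 1 -> dot v v = 1 -> dot u v = cos t -> 0 <= t <= pi -> sin t != 0 ->
  sin t *: principal_bivector u v = vec u * vec v - cos t *: 1.
Proof.
move=> uu vv uv t_pi st0; rewrite /principal_bivector.
have [uE|_] := eqVneq u v.
  by move: st0; rewrite -sqrf_eq0 sin2cos2 -uv uE vv expr1n subrr eqxx.
rewrite mvnorm_wedge_unit // vv uv -sin2cos2 sqrtr_sqr ger0_norm ?sin_ge0_pi //.
by rewrite scalerA divff // scale1r wedge_vecE -/(dot u v) uv.
Qed.

Lemma reversion_principal_bivector u v :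
  reversion (principal_bivector u v) = - principal_bivector u v.
Proof.
have revZ a M : reversion (a *: M) = a *: reversion M.
  by apply/ffunP => S; rewrite mvZE !ffunE; exact: mulrCA.
rewrite /principal_bivector; case: eqP => _; last first.
  by rewrite revZ reversion_wedge_vec scalerN.
by rewrite -(scale0r (0 : multivector R n)) revZ !scale0r oppr0.
Qed.

(** A zero angle would make [e i] and [f i] equal, giving a nonzero vector in [V :&: W]. *)
Lemma principal_angles_gt0 (p : nat) (V W : {vspace 'rV[R]_n})
    (e f : 'I_p -> 'rV[R]_n) (theta : 'I_p -> R) :
  (V :&: W)%VS = 0%VS -> principal_bases V W e f theta ->
  forall i, 0 < theta i <= pi / 2.
Proof.
move=> VW0 [_ [eV ee] [fW ff] tb ef] i; have /andP[t0 tpi] := tb i.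
rewrite tpi andbT lt_neqAle t0 andbT; apply/eqP => ti0.
have ef1 : dot (e i) (f i) = 1 by rewrite ef eqxx -ti0 cos0.
have : e i == f i.
  rewrite -subr_eq0; apply: contraTT isT => /dot_gt0.
  rewrite linearBl !linearBr /= [dot (f i) (e i)]dotC ef1 ee ff !eqxx !subrr.
  by rewrite ltxx.
move/eqP => eE; have : e i \in (V :&: W)%VS.
  rewrite memv_cap {2}eE (basis_mem eV) ?codom_f // (basis_mem fW) ?codom_f //.
rewrite VW0 memv0 => /eqP e0; have := ee i i.
by rewrite eqxx e0 linear0l => /eqP; rewrite eq_sym oner_eq0.
Qed.

(** A product of orthonormal vectors has norm 1, hence is nonzero and determines the sign. This
    reconciles the signs chosen in separate oriented angle bivectors. *)
Lemma blade_sign_uniq (p : nat) A (e : 'I_p -> 'rV[R]_n) (x y : R) :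
  (forall i, dot (e i) (e i) = 1) -> mvnorm A = 1 ->
  blade_sign A e x -> blade_sign A e y -> x = y.
Proof.
move=> ee A1 [_]; rewrite A1 mulr1 => Ax [_]; rewrite A1 mulr1 Ax => /eqP.
rewrite -subr_eq0 -scalerBl scaler_eq0.
by rewrite (negPf (mvnorm_neq0 (mvnorm_prod_unit ee))) orbF subr_eq0 => /eqP //.
Qed.

End PrincipalPlanes.

(** * Algebra of the principal planes and of the vectors [eperp i] *)

Section PrincipalFrames.
Variables (R : realType) (n p : nat) (e f eperp : 'I_p -> 'rV[R]_n).
Variable theta : 'I_p -> R.
Hypothesis p_gt0 : (0 < p)%N.
Hypothesis ee : orthonormal_family e.
Hypothesis ff : orthonormal_family f.
Hypothesis ef : forall i j,
  dot (e i) (f j) = if i == j :> nat then cos (theta i) else 0.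
Hypothesis theta_bound : forall i, 0 < theta i <= pi / 2.
Hypothesis eperpE : forall i,
  vec (eperp i) = principal_bivector (e i) (f i) * vec (f i).

Local Notation I i := (principal_bivector (e i) (f i)).
Local Notation J := (\prod_(i < p) I i).

Lemma sin_angle_gt0 i : 0 < sin (theta i).
Proof.
have /andP[t0 tpi] := theta_bound i; apply: sin_gt0_pi; rewrite t0 /=.
by apply: le_lt_trans tpi _; have := pi_gt0 R; lra.
Qed.

Lemma e_unit i : dot (e i) (e i) = 1. Proof. by rewrite ee eqxx. Qed.
Lemma f_unit i : dot (f i) (f i) = 1. Proof. by rewrite ff eqxx. Qed.
Lemma ef_diag i : dot (e i) (f i) = cos (theta i).
Proof. by rewrite ef eqxx. Qed.

Lemma sin_bivector i :
  sin (theta i) *: I i = vec (e i) * vec (f i) - cos (theta i) *: 1.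
Proof.
apply: sin_principal_bivector; rewrite ?e_unit ?f_unit ?ef_diag //; last first.
  by rewrite gt_eqF // sin_angle_gt0.
have /andP[t0 tpi] := theta_bound i; rewrite ltW //=.
by apply: le_trans tpi _; have := pi_gt0 R; lra.
Qed.

Lemma bivectorE i :
  I i = (sin (theta i))^-1 *: (vec (e i) * vec (f i) - cos (theta i) *: 1).
Proof.
by rewrite -sin_bivector scalerA mulVf ?scale1r // gt_eqF // sin_angle_gt0.
Qed.

(** Since [f_i f_i = 1], multiplying [e_i f_i - cos (theta i)] by [f_i] leaves
    [e_i - cos (theta i) f_i]; injectivity of [vec] carries this back to vectors. *)
Lemma eperp_combination i :
  eperp i = (sin (theta i))^-1 *: (e i - cos (theta i) *: f i).
Proof.
apply: vec_inj; rewrite eperpE bivectorE vecZ vecB vecZ.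
by rewrite -geomZl mulrBl -mulrA vec_sqr f_unit scale1r mulr1 -geomZl mul1r.
Qed.

Lemma e_decomposition i :
  e i = sin (theta i) *: eperp i + cos (theta i) *: f i.
Proof.
rewrite eperp_combination scalerA divff ?gt_eqF ?sin_angle_gt0 //.
by rewrite scale1r subrK.
Qed.

Lemma eperp_f i j : dot (eperp i) (f j) = 0.
Proof.
rewrite eperp_combination linearZl_LR linearBl linearZl_LR /= ef ff -val_eqE /=.
by case: eqP => _; rewrite ?mulr1 ?mulr0 subrr mulr0.
Qed.

Lemma e_eperp i j :
  dot (e i) (eperp j) = if i == j :> nat then sin (theta i) else 0.
Proof.
rewrite eperp_combination linearZr_LR linearBr linearZr_LR /= ef ee -val_eqE /=.
case: eqP => [/val_inj ->|_]; last by rewrite mulr0 subrr mulr0.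
by rewrite -expr2 -sin2cos2 expr2 mulKf // gt_eqF // sin_angle_gt0.
Qed.

(** Only one factor is expanded: its [f] part is orthogonal to every [eperp j], and its [e] part
    gives the sine that the normalisation cancels. *)
Lemma eperp_orthonormal : orthonormal_family eperp.
Proof.
move=> i j; rewrite [X in dot X]eperp_combination linearZl_LR linearBl linearZl_LR /=.
rewrite e_eperp [dot (f i) _]dotC eperp_f mulr0 subr0 -val_eqE /=.
by case: eqP => _; rewrite ?mulr0 // mulVf // gt_eqF // sin_angle_gt0.
Qed.

(** [vec v] anticommutes with both vectors spanning the plane, and the two signs cancel. *)
Lemma vec_bivector_comm v i : dot v (e i) = 0 -> dot v (f i) = 0 ->
  vec v * I i = I i * vec v.
Proof.
move=> ve vf; rewrite bivectorE -geomZr -geomZl mulrBr mulrBl; congr (_ *: (_ - _)).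
  by rewrite mulrA (vecMC_ortho ve) mulNr -mulrA (vecMC_ortho vf) mulrN opprK mulrA.
by rewrite -geomZr -geomZl mulr1 mul1r.
Qed.

(** With [c = cos (theta i)] one has [e f e f = 2 c e f - 1], whence [(e f - c)^2 = c^2 - 1], the
    opposite of the squared sine. *)
Lemma bivector_sqr i : I i * I i = -1.
Proof.
have ss : sin (theta i) ^+ 2 *: (I i * I i) = - (sin (theta i) ^+ 2 *: 1).
  rewrite [in LHS]expr2 -scalerA geomZr geomZl sin_bivector.
  have efefE : vec (e i) * vec (f i) * (vec (e i) * vec (f i)) =
      (cos (theta i) *+ 2) *: (vec (e i) * vec (f i)) - 1.
    rewrite -mulrA [vec (f i) * _]mulrA [vec (f i) * vec (e i)]vecMC dotC ef_diag.
    rewrite mulrBl mulrBr -mulrA vec_sqr f_unit scale1r.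
    by rewrite mulr1 vec_sqr e_unit scale1r -geomZl -geomZr mul1r.
  rewrite mulrBl !mulrBr efefE -!geomZr -!geomZl !mulr1 mul1r scalerA -expr2.
  rewrite mulr2n scalerDl sin2cos2 scalerBl scale1r opprB.
  move: (cos _ *: (_ * _)) (cos _ ^+ 2 *: 1) => X Y.
  by rewrite opprB [X + X - 1 - X]addrAC addrK [X - 1 + _]addrC addrA subrK.
apply: (scalerI (lt0r_neq0 (exprn_gt0 2 (sin_angle_gt0 i)))).
by rewrite ss scalerN.
Qed.

Lemma bivector_comm i j : I i * I j = I j * I i.
Proof.
have [->//|ij] := eqVneq i j.
have eC : vec (e j) * I i = I i * vec (e j).
  apply: vec_bivector_comm; first by rewrite ee eq_sym (negPf ij).
  by rewrite ef -[_ == _]/(j == i) eq_sym (negPf ij).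
have fC : vec (f j) * I i = I i * vec (f j).
  apply: vec_bivector_comm; last by rewrite ff eq_sym (negPf ij).
  by rewrite dotC ef -[_ == _]/(i == j) (negPf ij).
rewrite [I j]bivectorE -geomZr -geomZl mulrBr mulrBl; congr (_ *: (_ - _)).
  by rewrite mulrA -eC -!mulrA fC.
by rewrite -geomZr -geomZl mulr1 mul1r.
Qed.

Lemma inv_bivector_prod : J^-1 = \prod_(i < p) - I i.
Proof.
have NJ : \prod_(i < p) - I i * J = 1.
  rewrite -prodrM_comm_neq => [|i j _]; last first.
    by rewrite /GRing.comm mulNr mulrN bivector_comm.
  by rewrite big1 // => i _; rewrite mulNr bivector_sqr opprK.
have JN : J * \prod_(i < p) - I i = 1.
  rewrite -prodrM_comm_neq => [|i j _]; last first.
    by rewrite /GRing.comm mulNr mulrN bivector_comm.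
  by rewrite big1 // => i _; rewrite mulrN bivector_sqr opprK.
have JU : J \is a GRing.unit by apply/unitrP; exists (\prod_(i < p) - I i).
by apply: (mulrI JU); rewrite JN mulrV.
Qed.

(** [f_i] anticommutes with the bivector of a plane containing it, so
    [f_i (- I_i) = I_i f_i = eperp_i]; factors with distinct indices commute. *)
Lemma dual_prod_f : dual J (\prod_(i < p) vec (f i)) = \prod_(i < p) vec (eperp i).
Proof.
rewrite /dual inv_bivector_prod -prodrM_comm_neq => [|i j ij].
  apply: eq_bigr => i _; rewrite eperpE bivectorE -scalerN -geomZr -geomZl.
  congr (_ *: _); rewrite mulrN mulrBr mulrBl -geomZr -geomZl mulr1 mul1r opprB.
  rewrite mulrA [vec (f i) * vec (e i)]vecMC dotC ef_diag mulrBl -geomZl mul1r.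
  by rewrite mulr2n scalerDl opprB opprD addrCA addNKr.
rewrite /GRing.comm mulrN mulNr vec_bivector_comm //.
  by rewrite dotC ef -[_ == _]/(j == i) eq_sym (negPf ij).
by rewrite ff (negPf ij).
Qed.

(** Factor by factor, [(cos a + sin a I) (- I) = sin a - cos a I], whose coefficients are the cosine
    and sine of [a - pi / 2]. *)
Lemma dual_mvexp (a : 'I_p -> R) :
  dual J (mvexp (\sum_(i < p) a i *: I i)) = mvexp (\sum_(i < p) (a i - pi / 2) *: I i).
Proof.
rewrite !mvexp_sum //; try exact: bivector_sqr; try exact: bivector_comm.
rewrite /dual inv_bivector_prod -prodrM_comm_neq => [|i j _].
  apply: eq_bigr => i _; rewrite cosBpihalf sinBpihalf mulrDl -!geomZl mul1r.
  by rewrite mulrN bivector_sqr opprK scalerN scaleNr addrC.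
rewrite /GRing.comm mulrN mulNr mulrDl mulrDr -!geomZl -!geomZr mul1r mulr1.
by rewrite bivector_comm.
Qed.

(** Only the factor of index [k] changes, and it is negated. The conditions on [x] cover both [pi]
    and [- pi]. *)
Lemma mvexp_half_turn (a : 'I_p -> R) (k : 'I_p) (x : R) : cos x = -1 -> sin x = 0 ->
  mvexp (\sum_(i < p) a i *: I i + x *: I k) = - mvexp (\sum_(i < p) a i *: I i).
Proof.
move=> cosx sinx.
have -> : \sum_(i < p) a i *: I i + x *: I k =
    \sum_(i < p) (a i + (if i == k then x else 0)) *: I i.
  under [RHS]eq_bigr do rewrite scalerDl.
  rewrite big_split /=; congr (_ + _); rewrite (bigD1 k) //= eqxx big1 ?addr0 //.
  by move=> i /negPf ->; rewrite scale0r.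
rewrite !mvexp_sum //; try exact: bivector_sqr; try exact: bivector_comm.
transitivity (\prod_(i < p) ((if i == k then -1 else 1 : R) *:
    (cos (a i) *: 1 + sin (a i) *: I i))).
  apply: eq_bigr => i _; case: eqP => _; last by rewrite addr0 scale1r.
  by rewrite cosD sinD cosx sinx !mulr0 subr0 addr0 !mulrN1 scaleN1r opprD !scaleNr.
rewrite scaler_prod (bigD1 k) //= eqxx big1 => [|i /negPf -> //].
by rewrite mulr1 scaleN1r.
Qed.

(** Isolates the degenerate case, in which [principal_bivector (e i) (eperp i)] takes its default
    value 0. *)
Lemma eperp_eqP i : e i = eperp i <-> theta i = pi / 2.
Proof.
have pi0 := pi_gt0 R; have /andP[t0 tpi] := theta_bound i.
split=> [eE|tE]; last first.
  by rewrite [LHS]e_decomposition tE sin_pihalf cos_pihalf scale1r scale0r addr0.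
apply: cos_inj; rewrite ?in_itv /= ?cos_pihalf -?ef_diag ?eE ?eperp_f //; apply/andP; lra.
Qed.

(** With [c] and [s] the cosine and sine of [theta i], [e_i eperp_i - s = - (c / s) (e_i f_i - c) =
    - c I_i]. Here [c] is nonzero, since otherwise [s = 1] and [e_i = eperp_i]. *)
Lemma principal_bivector_eperp i : e i != eperp i ->
  principal_bivector (e i) (eperp i) = - I i.
Proof.
move=> e_neq.
have c0 : cos (theta i) != 0.
  apply: contraNneq e_neq => c0.
  rewrite [X in X == _]e_decomposition c0 scale0r addr0.
  have -> : sin (theta i) = 1; last by rewrite scale1r.
  have := sin_angle_gt0 i; have := sin2cos2 (theta i).
  rewrite c0 expr0n subr0 => /eqP; rewrite sqrf_eq1 => /orP[/eqP->//|/eqP->].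
  by rewrite ltr0N1.
have pi0 := pi_gt0 R; have /andP[t0 tpi] := theta_bound i.
have sE : sin (pi / 2 - theta i) = cos (theta i).
  by rewrite -opprB sinN sinBpihalf opprK.
have cE : cos (pi / 2 - theta i) = sin (theta i).
  by rewrite -opprB cosN cosBpihalf.
apply: (scalerI c0); rewrite -sE sin_principal_bivector ?cE ?sE ?e_unit ?e_eperp ?eqxx //.
- rewrite eperp_combination vecZ vecB vecZ -geomZr mulrBr -geomZr vec_sqr e_unit scale1r.
  have s0 : sin (theta i) != 0 by rewrite gt_eqF // sin_angle_gt0.
  apply: (scalerI s0); rewrite !scalerN scalerA mulrC -scalerA sin_bivector.
  rewrite scalerBr !scalerA divff // scale1r -expr2 sin2cos2 scalerBl scale1r.
  rewrite scalerBr scalerA -expr2; move: (cos _ *: (_ * _)) (cos _ ^+ 2 *: 1) => X Y.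
  by rewrite !opprB addrC addrA subrK.
- by have := eperp_orthonormal i i; rewrite eqxx.
- apply/andP; lra.
Qed.

(* [P] commutes with [e j] up to one sign as a multiple of [prod e], and, being the
   product of the [eperp i], with [f j] up to the opposite sign; this kills the
   component of [e j] along [f j]. *)
Lemma prod_e_neq_opp_prod_eperp :
  \prod_(i < p) vec (e i) <> - \prod_(i < p) vec (eperp i).
Proof.
set P := \prod_(i < p) vec (eperp i) => eP.
pose sg (j i : 'I_p) : R := if i == j then 1 else -1.
have ortho_prod (w : 'I_p -> 'rV[R]_n) j : orthonormal_family w ->
    vec (w j) * \prod_(i < p) vec (w i) =
    (\prod_(i < p) sg j i) *: (\prod_(i < p) vec (w i) * vec (w j)).
  move=> ww; apply: prod_quasicomm => i; rewrite /sg; case: eqP => [->|/eqP ij].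
    by rewrite scale1r.
  by rewrite scaleN1r; apply: vecMC_ortho; rewrite -[LHS]/(dot (w j) (w i)) ww eq_sym
    (negPf ij).
have P1 : mvnorm P = 1.
  by apply: mvnorm_prod_unit => i; have := eperp_orthonormal i i; rewrite eqxx.
have eE j : e j = eperp j.
  have ePj : vec (e j) * P = (\prod_(i < p) sg j i) *: (P * vec (e j)).
    by have := ortho_prod e j ee; rewrite eP mulrN mulNr scalerN => /oppr_inj.
  (* [f j] anticommutes with all p factors of [P], whereas [e j] changes sign only at the p - 1
     factors of [prod e] other than itself. *)
  have fPj : vec (f j) * P = - (\prod_(i < p) sg j i) *: (P * vec (f j)).
    rewrite (@prod_quasicomm _ _ _ _ _ (fun=> -1)) => [|i]; last first.
      rewrite scaleN1r; apply: vecMC_ortho.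
      by rewrite -[LHS]/(dot (f j) (eperp i)) dotC eperp_f.
    congr (_ *: _); rewrite (bigD1 j) //= [in RHS](bigD1 j) //=.
    rewrite [sg j j]/sg eqxx mul1r mulN1r.
    by congr (- _); apply: eq_bigr => i /negPf ij; rewrite /sg ij.
  have cfP : cos (theta j) *: (vec (f j) * P) = 0.
    apply: mv_mul2n_inj; rewrite mul0rn mulr2n.
    have cfE : cos (theta j) *: vec (f j) = vec (e j) - sin (theta j) *: vec (eperp j).
      by rewrite [X in vec X - _]e_decomposition -!vecZ -vecB addrC addKr.
    suff cfN : cos (theta j) *: (vec (f j) * P) = - (cos (theta j) *: (vec (f j) * P)).
      by rewrite {1}cfN addNr.
    transitivity ((\prod_(i < p) sg j i) *: (P * (cos (theta j) *: vec (f j)))).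
      rewrite geomZl cfE mulrBl mulrBr ePj -geomZl -geomZr.
      by rewrite (ortho_prod _ _ eperp_orthonormal) scalerBr !scalerA [sin _ * _]mulrC.
    by rewrite fPj -geomZr scaleNr scalerN opprK !scalerA mulrC.
  apply/eperp_eqP; have pi0 := pi_gt0 R; have /andP[t0 tpi] := theta_bound j.
  apply: cos_inj; rewrite ?in_itv /= ?cos_pihalf; first by apply/andP; lra.
    by apply/andP; lra.
  have := congr1 (@mvnorm R n) cfP.
  rewrite mvnormZ mvnorm_vecM P1 f_unit sqrtr1 !mulr1 -(scale0r (0 : multivector R n)).
  by rewrite mvnormZ normr0 mul0r => /normr0_eq0.
(* Once [e] and [eperp] agree, the assumed equation reads [P = - P]. *)
have PN : P = - P by rewrite -{1}eP; apply: eq_bigr => i _; rewrite eE.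
have /eqP := mvnorm_neq0 P1; apply; apply: mv_mul2n_inj.
by rewrite mul0rn mulr2n {2}PN subrr.
Qed.

(** * Angle bivectors of [V] with [W] and with its orthogonal complement *)

Section Subspaces.
Variables V W : {vspace 'rV[R]_n}.
Hypothesis eV : orthonormal_basis V e.
Hypothesis fW : orthonormal_basis W f.
Local Notation Wperp := (orthov (@dot R n) W).

(** In the degenerate case the principal bivector is 0 instead of [- I i], but then the coefficient
    [pi / 2 - theta i] vanishes as well. *)
Lemma angle_sum_eperp (tperp : 'I_p -> R) : (forall i, tperp i = pi / 2 - theta i) ->
  angle_sum tperp e eperp = \sum_(i < p) (theta i - pi / 2) *: I i.
Proof.
move=> tE; apply: eq_bigr => i _; rewrite tE.
have [/eperp_eqP ->|e_neq] := eqVneq (e i) (eperp i); first by rewrite subrr !scale0r.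
by rewrite principal_bivector_eperp // scalerN -scaleNr opprB.
Qed.

Lemma cos_inj_pihalf (x y : R) : 0 <= x <= pi / 2 -> 0 <= y <= pi / 2 ->
  cos x = cos y -> x = y.
Proof.
move=> /andP[x0 xpi] /andP[y0 ypi]; have pi0 := pi_gt0 R.
by apply: cos_inj; rewrite in_itv /=; apply/andP; lra.
Qed.

(** The angles inside an angle bivector are existentially quantified. They are pinned down by their
    cosines, the products [dot (e i) (f i)], as cosine is injective on [[0, pi / 2]]. *)
Lemma theta_uniq (q : nat) (V' U : {vspace 'rV[R]_n})
    (w : 'I_q -> 'rV[R]_n) (t : 'I_p -> R) :
  principal_bases V' U e w t ->
  (forall (i : 'I_p) (j : 'I_q), i = j :> nat -> w j = f i) ->
  forall i, t i = theta i.
Proof.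
move=> [pq _ _ tb ew] wf i; apply: cos_inj_pihalf => //.
  by have /andP[t0 ->] := theta_bound i; rewrite ltW.
by rewrite -ef_diag -(wf i (widen_ord pq i)) // ew eqxx.
Qed.

Lemma tperp_uniq (q : nat) (V' U : {vspace 'rV[R]_n})
    (w : 'I_q -> 'rV[R]_n) (t : 'I_p -> R) :
  principal_bases V' U e w t ->
  (forall (i : 'I_p) (j : 'I_q), i = j :> nat -> w j = eperp i) ->
  forall i, t i = pi / 2 - theta i.
Proof.
move=> [pq _ _ tb ew] wf i; apply: cos_inj_pihalf => //.
  by have /andP[t0 tpi] := theta_bound i; apply/andP; lra.
have := ew i (widen_ord pq i); rewrite eqxx => <-.
by rewrite (wf i) // e_eperp eqxx -opprB cosN cosBpihalf.
Qed.

Lemma tperp_bound i : 0 <= pi / 2 - theta i <= pi / 2.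
Proof. by have /andP[t0 tpi] := theta_bound i; apply/andP; lra. Qed.

Lemma angle_bivector_VW Phi : angle_bivector V W e f Phi ->
  Phi = \sum_(i < p) theta i *: I i.
Proof.
move=> [q [w [t [Vw wf ->]]]]; apply: eq_bigr => i _.
by rewrite (theta_uniq Vw).
Qed.

Lemma angle_bivector_VWperp Phi : angle_bivector V Wperp e eperp Phi ->
  Phi = \sum_(i < p) (theta i - pi / 2) *: I i.
Proof.
by move=> [q [w [t [Vw wf ->]]]]; apply: angle_sum_eperp; exact: tperp_uniq Vw wf.
Qed.

(** Any orthonormal completion [w] of [eperp] in the complement of [W] works: the [f i] component of
    [e i] is orthogonal to every [w j], so only [sin (theta i) *: eperp i] contributes to the
    products. *)
Lemma angle_bivector_VWperp_exists : exists Phi, angle_bivector V Wperp e eperp Phi.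
Proof.
have [fWb _] := fW.
have eperpW i : eperp i \in Wperp.
  apply/mem_orthovP => v; rewrite -(span_basis fWb) => vf.
  have : (<<codom f>> <= orthov (@dot R n) <[eperp i]>)%VS.
    by apply: codom_span_subv => j; rewrite mem_orthov1 -[X in X == 0]/(dot _ _) dotC
      eperp_f.
  by move/subvP/(_ v vf); rewrite mem_orthov1 -[X in X == 0]/(dot _ _) dotC => /eqP.
have [q [w [pq wW wE]]] := orthonormal_family_extend eperp_orthonormal eperpW.
exists (angle_sum (fun i => pi / 2 - theta i) e eperp), q, w, (fun i => pi / 2 - theta i).
split=> //; split=> // [i|i j]; first exact: tperp_bound.
have [[wb ww] [fb _]] := (wW, fW).
have wW0 : w j \in Wperp by apply: (basis_mem wb); exact: codom_f.
have fi : f i \in W by apply: (basis_mem fb); exact: codom_f.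
have fw : dot (w j) (f i) = 0 by move/mem_orthovP: wW0 => /(_ _ fi).
rewrite -opprB cosN cosBpihalf [e i]e_decomposition.
rewrite linearDl !linearZl_LR /= [dot (f i) _]dotC fw mulr0 addr0.
rewrite -(wE i (widen_ord pq i)) // ww -val_eqE /=.
by case: eqP => _; rewrite ?mulr1 ?mulr0.
Qed.

(* The sign is absorbed into the first vector. *)
Lemma blade_space_eperp (x : R) : x = 1 \/ x = -1 ->
  blade_space p (x *: \prod_(i < p) vec (eperp i)) <<codom eperp>>%VS.
Proof.
move=> x1; have xx : x * x = 1 by case: x1 => ->; rewrite ?mulrNN mulr1.
pose k0 := Ordinal p_gt0; pose a i := if i == k0 then x else 1.
have aa i : a i * a i = 1 by rewrite /a; case: eqP => _; rewrite ?mulr1.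
pose v i := a i *: eperp i; have aE i : eperp i = a i *: v i by rewrite scalerA aa scale1r.
exists v; split.
- rewrite big_wedge_ortho => [|i j ij]; last first.
    by rewrite linearZl_LR linearZr_LR /= eperp_orthonormal (negPf ij) !mulr0.
  under [RHS]eq_bigr do rewrite vecZ.
  rewrite scaler_prod; congr (_ *: _).
  rewrite (bigD1 k0) //= {1}/a eqxx big1 ?mulr1 // => i /negPf ik.
  by rewrite /a ik.
- rewrite scaler_eq0 negb_or mvnorm_neq0 ?andbT.
    by apply: contra_eq_neq xx => ->; rewrite mul0r eq_sym oner_eq0.
  by apply: mvnorm_prod_unit => i; have := eperp_orthonormal i i; rewrite eqxx.
apply/eqP; rewrite eqEsubv; apply/andP; split; apply: codom_span_subv => i.
  by rewrite aE rpredZ // mem_codom_span.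
by rewrite rpredZ // mem_codom_span.
Qed.

Lemma mul_signs (x y : R) : x = 1 \/ x = -1 -> y = 1 \/ y = -1 ->
  x * y = 1 \/ x * y = -1.
Proof.
by move=> [] -> [] ->; rewrite ?mulrNN ?mulr1 ?mul1r; [left|right|right|left].
Qed.

(** Opposite orientations add [- pi I_k], a half turn, so in both cases the exponential is
    multiplied by the relative sign [x * y]. *)
Lemma mvexp_oriented_VW A B Phi : mvnorm A = 1 -> mvnorm B = 1 ->
  oriented_angle_bivector A B e f Phi ->
  exists x y : R, [/\ blade_sign A e x, blade_sign B f y
    & dual J (mvexp Phi) =
      (x * y) *: mvexp (\sum_(i < p) (theta i - pi / 2) *: I i)].
Proof.
move=> A1 B1 [V0 [U0 [t [x [y [k [_ Vb [Ax By] _ ->]]]]]]].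
exists x, y; split=> //.
have -> : angle_sum t e f = \sum_(i < p) theta i *: I i.
  apply: eq_bigr => i _; rewrite (theta_uniq Vb) // => a b /val_inj -> //.
have [xy1|xyN] : x * y = 1 \/ x * y = -1.
- by apply: mul_signs; [case: Ax | case: By].
- by rewrite xy1 eqxx dual_mvexp scale1r.
(* As -1 differs from 1, the branch with the correction term applies. *)
rewrite xyN -subr_eq0 -opprD oppr_eq0 -mulr2n pnatr_eq0 /= -scaleNr.
rewrite mvexp_half_turn ?cosN ?cospi ?sinN ?sinpi ?oppr0 //.
by rewrite scaleN1r -dual_mvexp /dual mulNr.
Qed.

(** The correction, [- pi] times the principal bivector [- I_k], is again a half turn as long as
    [e k] and [eperp k] differ; for opposite signs, [A <> - C] ensures this. *)
Lemma mvexp_oriented_eperp A C Phi : mvnorm A = 1 -> mvnorm C = 1 -> A <> - C ->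
  oriented_angle_bivector A C e eperp Phi ->
  exists x y : R, [/\ blade_sign A e x, blade_sign C eperp y
    & mvexp Phi = (x * y) *: mvexp (\sum_(i < p) (theta i - pi / 2) *: I i)].
Proof.
move=> A1 C1 AC [V0 [U0 [t [x [y [k [_ Vb [Ax Cy] tk ->]]]]]]].
exists x, y; split=> //.
have tE : forall i, t i = pi / 2 - theta i.
  by apply: (tperp_uniq Vb) => a b /val_inj ->.
rewrite (angle_sum_eperp tE).
have [xy1|xyN] : x * y = 1 \/ x * y = -1.
- by apply: mul_signs; [case: Ax | case: Cy].
- by rewrite xy1 eqxx scale1r.
rewrite xyN -subr_eq0 -opprD oppr_eq0 -mulr2n pnatr_eq0 /= scaleN1r principal_bivector_eperp.
  by rewrite scalerN opprK mvexp_half_turn // ?cospi ?sinpi.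
(* If the largest angle vanishes, [e] and [eperp] coincide. *)
apply: contra_not_neq AC => /eperp_eqP tk_pi.
have eE i : e i = eperp i.
  apply/eperp_eqP; have := tk i; rewrite !tE tk_pi subrr.
  by have /andP[_ ti] := theta_bound i; lra.
have yy : y * y = 1 by case: Cy => -[] -> _; rewrite ?mulrNN mulr1.
have xE : x = - y by rewrite -[x]mulr1 -yy mulrA xyN mulN1r.
case: Ax => _ ->; case: Cy => _ ->; rewrite A1 C1 !mulr1 -scaleNr xE.
by under eq_bigr do rewrite eE.
Qed.

End Subspaces.

End PrincipalFrames.

(** If [A = - Bstar], then [e] and [eperp] coincide, so the oriented angle bivector of [A] and
    [Bstar] is 0 by convention, while the dual exponential is -1. The last clause treats this case
    with [reversion (I k)] in place of the vanishing principal bivector, for every [k] because all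
    angles with [Wperp] are 0. The existence claims keep the identities from holding vacuously. *)
Theorem proposition4p7 (R : realType) (n p : nat) (A B : multivector R n)
  (V W : {vspace 'rV[R]_n}) (e f eperp : 'I_p -> 'rV[R]_n) (theta : 'I_p -> R)
  (p_ge1 : (1 <= p)%N)
  (blade_A : blade_space p A V) (unit_A : mvnorm A = 1)
  (blade_B : blade_space p B W) (unit_B : mvnorm B = 1)
  (VW0 : (V :&: W)%VS = 0%VS)
  (principal_VW : principal_bases V W e f theta)
  (theta_le : forall i j : 'I_p, (i <= j)%N -> theta i <= theta j)
  (eperpE : forall i,
     vec (eperp i) = principal_bivector (e i) (f i) * vec (f i)) :
  let I := fun i => principal_bivector (e i) (f i) in
  let J := \prod_(i < p) I i in
  let Wperp := orthov (@dot R n) W in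
  let Bstar := dual J B in
  [/\ forall Phi, angle_bivector V W e f Phi ->
        (exists Phi', angle_bivector V Wperp e eperp Phi') /\
        forall Phi', angle_bivector V Wperp e eperp Phi' ->
          dual J (mvexp Phi) = mvexp Phi',
      forall Phi, oriented_angle_bivector A B e f Phi ->
        (exists Phi', oriented_angle_bivector A Bstar e eperp Phi') /\
        forall Phi', oriented_angle_bivector A Bstar e eperp Phi' ->
          A <> - Bstar -> dual J (mvexp Phi) = mvexp Phi'
    & A = - Bstar ->
        forall Phi, oriented_angle_bivector A B e f Phi ->
        forall Phi', angle_bivector V Wperp e eperp Phi' ->
        forall k, dual J (mvexp Phi) = mvexp (Phi' - pi *: reversion (I k))].
Proof.
move=> I J Wperp Bstar.
have [_ eV fW tb ef] := principal_VW; have [_ ee] := eV; have [_ ff] := fW.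
have theta_gt0 := principal_angles_gt0 VW0 principal_VW.
have BstarE y : blade_sign B f y -> Bstar = y *: \prod_(i < p) vec (eperp i).
  rewrite /blade_sign unit_B mulr1 => -[_ BE]; rewrite /Bstar {1}BE.
  by rewrite -(dual_prod_f ee ff ef theta_gt0 eperpE) /dual geomZl.
have perp1 : mvnorm (\prod_(i < p) vec (eperp i)) = 1.
  apply: mvnorm_prod_unit => i.
  by rewrite (eperp_orthonormal ee ff ef theta_gt0 eperpE) eqxx.
have Bstar1 y : blade_sign B f y -> mvnorm Bstar = 1.
  move=> By; rewrite (BstarE y By) mvnormZ perp1 mulr1.
  by case: By => -[] -> _; rewrite ?normrN normr1.
have Bstar_sign y : blade_sign B f y -> blade_sign Bstar eperp y.
  move=> By; split; first by case: By.
  by rewrite (Bstar1 y By) mulr1; exact: BstarE.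
split.
- move=> Phi /(angle_bivector_VW ef theta_gt0) ->; split.
    exact: (angle_bivector_VWperp_exists ee ff ef theta_gt0 eperpE eV fW).
  move=> Phi' /(angle_bivector_VWperp ee ff ef theta_gt0 eperpE) ->.
  exact: (dual_mvexp p_ge1 ee ff ef theta_gt0).
- move=> Phi /(mvexp_oriented_VW p_ge1 ee ff ef theta_gt0 unit_A unit_B).
  move=> [x [y [Ax By ->]]]; split.
    (* The first index has the smallest [theta], hence the largest [pi / 2 - theta]. *)
    pose k0 := Ordinal p_ge1.
    eexists; exists V, <<codom eperp>>%VS, (fun i => pi / 2 - theta i), x, y, k0.
    split; [split=> //| |split|move=> i|reflexivity].
    + rewrite (BstarE y By).
      by apply: (blade_space_eperp p_ge1 ee ff ef theta_gt0 eperpE); case: By.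
    + split=> //.
      * exact/orthonormal_family_basis/(eperp_orthonormal ee ff ef theta_gt0 eperpE).
      * by move=> i; exact: tperp_bound.
      * move=> i j; rewrite (e_eperp ee ff ef theta_gt0 eperpE).
        by rewrite -opprB cosN cosBpihalf.
    + by [].
    + exact: Bstar_sign.
    + by rewrite lerD2l lerN2 theta_le.
  move=> Phi' PhiE AB.
  have [x' [y' [Ax' By' ->]]] := mvexp_oriented_eperp p_ge1 ee ff ef theta_gt0
    eperpE unit_A (Bstar1 y By) AB PhiE.
  rewrite (blade_sign_uniq _ unit_A Ax Ax') => [|i]; last by rewrite ee eqxx.
  rewrite (blade_sign_uniq _ (Bstar1 y By) (Bstar_sign y By) By') // => i.
  by rewrite (eperp_orthonormal ee ff ef theta_gt0 eperpE) eqxx.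
move=> AB Phi /(mvexp_oriented_VW p_ge1 ee ff ef theta_gt0 unit_A unit_B).
move=> [x [y [Ax By ->]]] Phi' /(angle_bivector_VWperp ee ff ef theta_gt0 eperpE) -> k.
rewrite reversion_principal_bivector scalerN opprK.
rewrite (mvexp_half_turn p_ge1 ee ff ef theta_gt0) ?cospi ?sinpi //.
have yy : y * y = 1 by case: By => -[] -> _; rewrite ?mulrNN mulr1.
(* Only opposite signs are compatible with [A = - Bstar]: equal ones would make [prod e] the
   opposite of [prod eperp]. *)
have [xy1|->] : x * y = 1 \/ x * y = -1; last by rewrite scaleN1r.
  by apply: mul_signs; [case: Ax | case: By].
have xE : x = y by rewrite -[x]mulr1 -yy mulrA xy1 mul1r.
case: (prod_e_neq_opp_prod_eperp ee ff ef theta_gt0 eperpE).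
have y0 : y != 0 by apply: contra_eq_neq yy => ->; rewrite mul0r eq_sym oner_eq0.
apply: (scalerI y0); rewrite scalerN -(BstarE y By) -AB.
by case: Ax => _ ->; rewrite unit_A mulr1 xE.
Qed.
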